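(* Let $k$ be a positive integer. Let $x_1,\ldots,x_k\in C^1(\mathbb{R})$ be real-valued and $\frac{\pi}{k+1}$-periodic, and let $z\in C^1(\mathbb{R})$ be real-valued and $\frac{\pi}{k+1}$-antiperiodic, such that \[ \sum_{j=1}^kx_j(\theta)^2+z(\theta)^2=1 \] for every $\theta\in\mathbb{R}$ and \[ \int_0^{2\pi}\bigg(x_j(\theta)^2-\frac{2}{2k+1}\bigg)\sqrt{\sum_{\ell=1}^k\big(x_\ell'(\theta)^2+\ell^2x_\ell(\theta)^2\big)+z'(\theta)^2}\,d\theta=0 \] for each $j\in\{1,\ldots,k\}$. Then $\gamma\colon[0,2\pi)\to S^{2k}$ defined by \[ \gamma(\theta):=\big(x_1(\theta)\cos\theta,\ x_1(\theta)\sin\theta,\ x_2(\theta)\cos2\theta,\ x_2(\theta)\sin2\theta,\ \ldots,\ x_k(\theta)\cos k\theta,\ x_k(\theta)\sin k\theta,\ z(\theta)\big) \] is a spherical $2$-design curve.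
   Context: A function $f\colon\mathbb{R}\to\mathbb{R}$ is $p$-antiperiodic if $f(x+p)=-f(x)$ for all $x\in\mathbb{R}$. $S^d$ is the unit sphere in $\mathbb{R}^{d+1}$, $\sigma$ is the uniform (rotation-invariant) probability measure on $S^d$, and $\Pi_d^t$ is the vector space of restrictions to $S^d$ of real polynomials on $\mathbb{R}^{d+1}$ of degree at most $t$. Let $\gamma\colon[0,2\pi)\to S^d$ be a Lipschitz parameterization of a closed rectifiable curve (closed: $\gamma(\theta)\to\gamma(0)$ as $\theta\to 2\pi^-$), with arclength $L(\gamma):=\int_0^{2\pi}\|\gamma'(\theta)\|\,d\theta$. The curve $\gamma$ is a spherical $t$-design curve (or $t$-design curve) in $S^d$ if for all $f\in\Pi_d^t$, \[ \int_{S^d}f(x)\,d\sigma(x)=\frac{1}{L(\gamma)}\int_0^{2\pi}f(\gamma(\theta))\,\|\gamma'(\theta)\|\,d\theta. \] *)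

(* Defs.v *)
From HB Require Import structures.
From mathcomp Require Import all_boot all_order all_algebra.
From mathcomp Require Import all_classical all_reals all_analysis.
From mathcomp Require mpoly.
(* The notations of mpoly are incompatible with those of MathComp-Analysis. *)
Import (canonicals, coercions) mpoly.
Set Implicit Arguments.
Unset Strict Implicit.
Unset Printing Implicit Defensive.
Import Order.TTheory GRing.Theory Num.Theory.
Import numFieldNormedType.Exports.
Local Open Scope classical_set_scope.
Local Open Scope ring_scope.

Definition antiperiodic (R : realType) (f : R -> R) (p : R) : Prop :=
  forall u, f (u + p) = - f u.

Definition continuously_differentiable (R : realType) (f : R -> R) : Prop :=
  (forall u, derivable f u 1) /\ continuous (derive1 f).

(* The library norm `|x| on 'rV[R]_n is the sup norm, hence a separate name
   for the Euclidean one. *)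
Definition enorm (R : realType) (n : nat) (x : 'rV[R]_n) : R :=
  Num.sqrt (\sum_(i < n) x ord0 i ^+ 2).

Definition sphere (R : realType) (d : nat) : set 'rV[R]_d.+1 :=
  [set x | enorm x = 1].
Arguments sphere : clear implicits.

Definition borel_rV (R : realType) (n : nat) :=
  g_sigma_algebraType (@open 'rV[R]_n).

(* The uniform measure on S^d, seen as a Borel measure on R^(d+1) carried by
   S^d: the rotation-invariant probability measure.  Invariance is under the
   whole orthogonal group, which determines the measure for every d (for d = 0
   the group SO(1) is trivial). *)
Definition uniform_sphere_measure (R : realType) (d : nat)
    (sigma : probability (borel_rV R d.+1) R) : Prop :=
  sigma (sphere R d) = 1%E /\
  forall Q : 'M[R]_d.+1, Q *m Q^T = 1%:M ->
  forall A : set (borel_rV R d.+1), measurable A ->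
    sigma [set x : 'rV[R]_d.+1 | A (x *m Q)] = sigma A.

(* A curve [0, 2pi) -> S^d is represented by a function on R of which only the
   values on [0, 2pi) matter; the derivative of the function at 0 may depend on
   other values, but a single point does not affect the integrals below.  A
   Lipschitz curve is differentiable almost everywhere, and the total operator
   derive1 is used under the integral sign. *)
Definition curve_length (R : realType) (d : nat) (gamma : R -> 'rV[R]_d.+1)
    : R :=
  \int[lebesgue_measure]_(theta in `[0, 2 * pi[) enorm (derive1 gamma theta).

Definition lipschitz_closed_curve (R : realType) (d : nat)
    (gamma : R -> 'rV[R]_d.+1) : Prop :=
  [/\ forall theta, theta \in `[0, 2 * pi[ -> sphere R d (gamma theta),
      exists K : R, forall s t, s \in `[0, 2 * pi[ -> t \in `[0, 2 * pi[ ->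
        enorm (gamma s - gamma t) <= K * `|s - t|
    & gamma theta @[theta --> (2 * pi)^'-] --> gamma 0].

(* mpoly.msize p is 1 + the total degree of p (0 if p = 0). *)
Definition spherical_design_curve (R : realType) (d : nat)
    (sigma : probability (borel_rV R d.+1) R) (t : nat)
    (gamma : R -> 'rV[R]_d.+1) : Prop :=
  lipschitz_closed_curve gamma /\
  forall p : mpoly.mpoly d.+1 R, (mpoly.msize p <= t.+1)%N ->
    \int[sigma]_(x in sphere R d)
      mpoly.meval ((x : 'rV[R]_d.+1) ord0) p =
    (curve_length gamma)^-1 *
    \int[lebesgue_measure]_(theta in `[0, 2 * pi[)
      (mpoly.meval (gamma theta ord0) p * enorm (derive1 gamma theta)).

(* With x_1, ..., x_k indexed as x 0, ..., x (k-1), the coordinates number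
   2j and 2j+1 (j < k) are x_(j+1) cos (j+1)theta and x_(j+1) sin (j+1)theta;
   insub fails exactly for the last coordinate i = 2k. *)
Definition twisted_curve (R : realType) (k : nat) (x : 'I_k -> R -> R)
    (z : R -> R) (theta : R) : 'rV[R]_(2 * k).+1 :=
  \row_(i < (2 * k).+1)
    if insub i./2 is Some j then
      x j theta * (if odd i then sin (j.+1%:R * theta)
                   else cos (j.+1%:R * theta))
    else z theta.

Lemma twisted_curve_cos (R : realType) k (x : 'I_k -> R -> R) z theta
    (j : 'I_k) :
  twisted_curve x z theta ord0 (inord (2 * j)) =
  x j theta * cos (j.+1%:R * theta).
Proof.
have jk := ltn_ord j.
rewrite mxE inordK; last by rewrite ltnS leq_mul2l ltnW ?orbT.
by rewrite mul2n doubleK valK odd_double.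
Qed.

Lemma twisted_curve_sin (R : realType) k (x : 'I_k -> R -> R) z theta
    (j : 'I_k) :
  twisted_curve x z theta ord0 (inord (2 * j).+1) =
  x j theta * sin (j.+1%:R * theta).
Proof.
have jk := ltn_ord j.
rewrite mxE inordK; last by rewrite ltnS ltn_mul2l.
by rewrite mul2n -[_.+1]/(true + _)%N half_bit_double valK oddD odd_double.
Qed.

Lemma twisted_curve_last (R : realType) k (x : 'I_k -> R -> R) z theta :
  twisted_curve x z theta ord0 ord_max = z theta.
Proof. by rewrite mxE /= mul2n doubleK insubN ?ltnn. Qed.

(* Main.v *)
(** Put a = pi / (k + 1).  Every coordinate of the curve has the form
f(theta) cos(m theta) or f(theta) sin(m theta) with 0 <= m <= k and
f(theta + a) = f(theta), or, for the last coordinate, m = 0 and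
f(theta + a) = - f(theta), and the speed is a-periodic.  Monomials of degree 1
and 2 against the speed are therefore combinations of integrals over a period of
g cos(r theta) and g sin(r theta) with g(theta + a) = e g(theta), e = 1 or -1.
Shifting theta by a rotates this pair of integrals, so that both vanish unless
cos(r a) = e.  The frequency bounds leave only the squares of the coordinates,
whose integrals are prescribed by the integral condition and the equation of the
sphere.  On the sphere, reflections and transpositions of the coordinates
give the same moments. *)
Require Import Defs.
From HB Require Import structures.
From mathcomp Require Import all_boot all_order all_algebra.
From mathcomp Require Import all_classical all_reals all_analysis.
From mathcomp Require Import measurable_realfun ring lra.
From mathcomp Require mpoly.
Import (canonicals, coercions) mpoly.
Import Order.TTheory GRing.Theory Num.Theory.
Import numFieldNormedType.Exports.
Local Open Scope classical_set_scope.
Local Open Scope ring_scope.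

(** * Linearity of real integrals; continuity of sums and products *)

Lemma integrable_scale d (T : measurableType d) (R : realType)
    (mu : {measure set T -> \bar R}) (D : set T) (c : R) (f : T -> R) :
  measurable D -> mu.-integrable D (EFin \o f) ->
  mu.-integrable D (EFin \o (fun x => c * f x)).
Proof.
move=> mD fi; rewrite (_ : EFin \o _ = fun x => (c%:E * (EFin \o f) x)%E) //.
exact: integrableZl.
Qed.

Lemma Rintegral_sum dT (T : measurableType dT) (R : realType)
    (mu : {measure set T -> \bar R}) (D : set T) (I : Type)
    (r : seq I) (f : I -> T -> R) : measurable D ->
  (forall i, mu.-integrable D (EFin \o f i)) ->
  \int[mu]_(x in D) (\sum_(i <- r) f i x) =
  \sum_(i <- r) \int[mu]_(x in D) f i x.
Proof.
move=> mD fi; elim: r => [|i r ih].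
  under eq_Rintegral do rewrite big_nil.
  by rewrite big_nil Rintegral_cst // mul0r.
rewrite big_cons -ih -RintegralD //.
  by under eq_Rintegral do rewrite big_cons.
have := @integrable_sum _ T R mu D mD _ r xpredT (fun i => EFin \o f i)
  (fun i _ => fi i).
by apply: eq_integrable => // x _ /=; rewrite sumEFin.
Qed.

Lemma continuous_sum (R : realType) (T : topologicalType) (I : Type) (r : seq I)
    (f : I -> T -> R) :
  (forall i, continuous (f i)) -> continuous (fun x => \sum_(i <- r) f i x).
Proof.
move=> cf; elim: r => [|i r ih] x.
  by under eq_fun do rewrite big_nil; exact: cvg_cst.
by under eq_fun do rewrite big_cons; apply: continuousD; [exact: cf|exact: ih].
Qed.

Lemma continuous_fun_mul (R : realType) (T : topologicalType) (f g : T -> R) :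
  continuous f -> continuous g -> continuous (fun u => f u * g u).
Proof. by move=> cf cg u; apply: continuousM; [exact: cf|exact: cg]. Qed.

Lemma continuous_fun_add (R : realType) (T : topologicalType) (f g : T -> R) :
  continuous f -> continuous g -> continuous (fun u => f u + g u).
Proof. by move=> cf cg u; apply: continuousD; [exact: cf|exact: cg]. Qed.

Lemma continuous_fun_sqr (R : realType) (f : R -> R) :
  continuous f -> continuous (fun u => f u ^+ 2).
Proof.
move=> cf u; apply: (@continuous_comp _ _ _ f (fun t : R => t ^+ 2)).
  exact: cf.
exact: exprn_continuous.
Qed.

(** * Integrals of periodic functions against cosines and sines *)

Section periodic_integrals.
Context {R : realType}.
Notation mu := (@lebesgue_measure R).
Implicit Types (f g : R -> R) (a b c T : R).

Lemma continuous_integrable_segment f a b : continuous f ->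
  mu.-integrable `[a, b] (EFin \o f).
Proof.
move=> cf; apply: continuous_compact_integrable.
  exact: segment_compact.
exact: continuous_subspaceT.
Qed.

Lemma continuous_addr c : continuous (fun u : R => u + c).
Proof. by move=> u; apply: continuousD; [exact: cvg_id|exact: cvg_cst]. Qed.

Lemma continuous_mulr_cst c : continuous (fun u : R => c * u).
Proof. by move=> u; apply: continuousM; [exact: cvg_cst|exact: cvg_id]. Qed.

Lemma Rintegral_shift f a b c : a <= b -> continuous f ->
  \int[mu]_(u in `[a + c, b + c]) f u = \int[mu]_(u in `[a, b]) f (u + c).
Proof.
move=> ab cf.
have D (u : R) : is_derive u 1 (fun u : R => u + c) 1.
  by apply: is_derive_eq; rewrite addr0.
have dE : derive1 (fun u : R => u + c) = cst 1.
  by apply/funext => u; rewrite derive1E derive_val.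
rewrite /Rintegral.
rewrite (@integration_by_substitution_increasing _ (fun u => u + c)) //=.
- by congr fine; apply: eq_integral => u _; rewrite dE /= mulr1.
- by move=> u v _ _; rewrite ltrD2r.
- by rewrite dE => u _; exact: cvg_cst.
- by rewrite dE; exact: is_cvg_cst.
- by rewrite dE; exact: is_cvg_cst.
- split.
  + by move=> u _; apply: ex_derive.
  + by apply: cvg_at_right_filter; exact: continuous_addr.
  + by apply: cvg_at_left_filter; exact: continuous_addr.
- exact: continuous_subspaceT.
Qed.

Lemma Rintegral_cat f a b c : a <= b -> b <= c -> continuous f ->
  \int[mu]_(u in `[a, c]) f u =
  \int[mu]_(u in `[a, b]) f u + \int[mu]_(u in `[b, c]) f u.
Proof.
move=> ab bc cf.
have fi d e := continuous_integrable_segment f d e cf.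
rewrite -(@Rintegral_itv_obnd_cbnd _ b); last first.
  apply: integrableS (fi b c) => //.
  by apply: subset_itvr; rewrite bnd_simp.
by rewrite -(@Rintegral_itvB _ f (BLeft a) (BRight c)) ?bnd_simp // addrC subrK.
Qed.

(** The interval from 0 to [T + c] is cut once at [c] and once at [T]; by periodicity the piece
    beyond [T] has the same integral as the piece from 0 to [c], and the two cancel. *)
Lemma Rintegral_periodic f T c : 0 <= T -> 0 <= c -> continuous f ->
  periodic f T ->
  \int[mu]_(u in `[0, T]) f (u + c) = \int[mu]_(u in `[0, T]) f u.
Proof.
move=> T0 c0 cf fT.
have cT := ler_wpDl T0 (lexx c); have Tc : T <= T + c by rewrite lerDl.
have := Rintegral_cat f 0 c (T + c) c0 cT cf.
rewrite (Rintegral_cat f 0 T (T + c) T0 Tc cf).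
have -> : \int[mu]_(u in `[T, T + c]) f u = \int[mu]_(u in `[0, c]) f u.
  rewrite -[X in `[X, _]](add0r T) [T + c]addrC Rintegral_shift //.
  by apply: eq_Rintegral => u _; rewrite fT.
rewrite addrC => /addrI ->.
by rewrite -[X in _ = \int[mu]_(u in `[X, _]) _](add0r c) Rintegral_shift.
Qed.

(* The shift by [a] acts on the pair of integrals of [f cos] and [f sin] as
   [e] times the rotation of angle [r * a], which has no nonzero fixed point
   unless [cos (r * a) = e]. *)
Lemma Rintegral_trig_eq0 f T a r (e : R) : 0 <= T -> 0 <= a -> continuous f ->
  periodic f T -> cos (r * T) = 1 ->
  (forall u, f (u + a) = e * f u) -> e ^+ 2 = 1 -> cos (r * a) != e ->
  \int[mu]_(u in `[0, T]) (f u * cos (r * u)) = 0 /\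
  \int[mu]_(u in `[0, T]) (f u * sin (r * u)) = 0.
Proof.
move=> T0 a0 cf fT crT fa e2 cra.
have srT : sin (r * T) = 0 by apply: cos1sin0; rewrite crT normr1.
have cC : continuous (fun u => f u * cos (r * u)).
  move=> u; apply: continuousM; first exact: cf.
  apply: continuous_comp; first exact: continuous_mulr_cst.
  exact: continuous_cos.
have cS : continuous (fun u => f u * sin (r * u)).
  move=> u; apply: continuousM; first exact: cf.
  apply: continuous_comp; first exact: continuous_mulr_cst.
  exact: continuous_sin.
have pC : periodic (fun u => f u * cos (r * u)) T.
  by move=> u; rewrite fT mulrDr cosD crT srT; congr (_ * _); ring.
have pS : periodic (fun u => f u * sin (r * u)) T.
  by move=> u; rewrite fT mulrDr sinD crT srT; congr (_ * _); ring.
set C := \int[mu]_(u in _) (f u * cos _).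
set S := \int[mu]_(u in _) (f u * sin _).
have iC := continuous_integrable_segment _ 0 T cC.
have iS := continuous_integrable_segment _ 0 T cS.
have iZ k g : mu.-integrable `[0, T] (EFin \o g) ->
    mu.-integrable `[0, T] (EFin \o (fun u => k * g u)).
  by move=> gi; exact: integrable_scale.
set p := e * cos (r * a); set q := e * sin (r * a).
have EC : C = p * C - q * S.
  rewrite {1}/C -(Rintegral_periodic _ T a T0 a0 cC pC) -RintegralZl //.
  rewrite -RintegralZl // -RintegralB //; try exact: iZ.
  by apply: eq_Rintegral => u _; rewrite fa mulrDr cosD /p /q; ring.
have ES : S = q * C + p * S.
  rewrite {1}/S -(Rintegral_periodic _ T a T0 a0 cS pS) -RintegralZl //.
  rewrite -RintegralZl // -RintegralD //; try exact: iZ.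
  by apply: eq_Rintegral => u _; rewrite fa mulrDr sinD /p /q; ring.
(* Since [e ^+ 2 = 1], the equality [e * cos (r * a) = 1] would force [cos (r * a) = e]. *)
have p1 : 1 - p != 0.
  apply: contra cra; rewrite subr_eq0 => /eqP p1; apply/eqP.
  by rewrite -[LHS]mul1r -e2 expr2 -mulrA -/p -p1 mulr1.
(* This is the determinant of the linear system [EC], [ES] in the unknowns [C] and [S]; [C0] and
   [S0] are Cramer's rule. *)
have pq0 : (1 - p) ^+ 2 + q ^+ 2 != 0.
  by apply: lt0r_neq0; rewrite ltr_wpDr ?sqr_ge0 // exprn_even_gt0.
have C0 : ((1 - p) ^+ 2 + q ^+ 2) * C = 0.
  have -> : ((1 - p) ^+ 2 + q ^+ 2) * C =
    (1 - p) * (C - (p * C - q * S)) - q * (S - (q * C + p * S)) by ring.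
  by rewrite -EC -ES !subrr !mulr0 subrr.
have S0 : ((1 - p) ^+ 2 + q ^+ 2) * S = 0.
  have -> : ((1 - p) ^+ 2 + q ^+ 2) * S =
    q * (C - (p * C - q * S)) + (1 - p) * (S - (q * C + p * S)) by ring.
  by rewrite -EC -ES !subrr !mulr0 addr0.
by split; apply: (mulfI pq0); rewrite mulr0.
Qed.

(** Half-angle argument: a cosine equal to 1 would make the sine of [s / 2] vanish, although this
    angle lies strictly between 0 and pi. *)
Lemma cos_neq1 (t : R) : t != 0 -> `|t| < pi *+ 2 -> cos t != 1.
Proof.
move=> t0 t2; rewrite -cos_norm; set s := `|t|.
have s0 : 0 < s by rewrite normr_gt0.
apply/eqP => c1.
have : cos (s / 2 *+ 2) = 1.
  by rewrite -mulr_natr divfK ?pnatr_eq0.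
rewrite cos_mulr2n => c2.
have : sin (s / 2) != 0.
  apply: lt0r_neq0; apply: sin_gt0_pi; rewrite divr_gt0 //=.
  by rewrite ltr_pdivrMr // mulr_natr.
rewrite -sqrf_eq0 sin2cos2 => /eqP; apply.
by move: c2; set c := cos _ ^+ 2; rewrite -mulr_natr; lra.
Qed.

(** The angle [t + pi] lies strictly between 0 and 2 pi, so its cosine, which is [- cos t], is not
    1. *)
Lemma cos_neqN1 (t : R) : `|t| < pi -> cos t != -1.
Proof.
rewrite ltr_norml => /andP[t1 t2].
have t0 : 0 < t + pi by rewrite -ltrBlDr sub0r.
have : cos (t + pi) != 1.
  apply: cos_neq1; first exact: lt0r_neq0.
  by rewrite gtr0_norm // mulr2n ltrD2r.
by rewrite cosDpi; apply: contra => /eqP ->; rewrite opprK.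
Qed.
End periodic_integrals.

(** There are finitely many entries, so the conditions on the single entries can be intersected
    inside the filter. *)
Lemma cvg_mx_coord {R : numFieldType} {T : Type} {F : set_system T}
    {FF : Filter F} {m n : nat} (f : T -> 'M[R]_(m, n)) (M : 'M[R]_(m, n)) :
  (forall i j, f x i j @[x --> F] --> M i j) -> f x @[x --> F] --> M.
Proof.
move=> fM; apply/cvg_mx_entourageP => A entA.
have H i j : \forall x \near F, (M i j, f x i j) \in A.
  have /(_ A entA) H := (cvg_entourageP (fmap_filter _ FF) _).1 (fM i j).
  by apply: (@filterS _ F FF _ _ _ H) => x; rewrite inE.
have {}H i := @filter_forall _ _ _ F FF (H i).
exact: (@filter_forall _ _ _ F FF H).
Qed.

(** * Moments of degree one and two of the uniform measure on the sphere *)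

Section sphere_moments.
Context {R : realType} {d : nat}.
Local Notation E := (borel_rV R d.+1).
Variable sigma : probability E R.
Hypothesis hsigma : uniform_sphere_measure sigma.
Notation S := (sphere R d).
Notation rot Q := (fun x : 'rV[R]_d.+1 => x *m Q).

Lemma continuous_borel_measurable (f : 'rV[R]_d.+1 -> R) :
  continuous f -> measurable_fun setT (f : E -> R).
Proof.
move=> /continuousP cf; apply: (measurability _ (RGenOpens.measurableE R)).
move=> _ [_ [a [b ->]] <-]; rewrite setTI.
by apply: sub_sigma_algebra; apply: cf; exact: interval_open.
Qed.

Lemma continuous_rotation (Q : 'M[R]_d.+1) : continuous (rot Q).
Proof.
move=> x; apply: (@cvg_mx_coord _ _ _ (nbhs_filter x)) => i j; rewrite mxE.
under eq_fun do rewrite mxE.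
apply: (continuous_sum _ _ _ _
  (fun k (y : 'rV[R]_d.+1) => y i k * Q k j)) => k y.
by apply: continuousM; [exact: coord_continuous|exact: cst_continuous].
Qed.

Lemma measurable_rotation (Q : 'M[R]_d.+1) :
  measurable_fun setT (rot Q : E -> E).
Proof.
apply: measurability => // _ [B oB <-]; rewrite setTI.
apply: sub_sigma_algebra.
exact: (continuousP _).1 (continuous_rotation Q) B oB.
Qed.

Lemma measurable_sphere : measurable (S : set E).
Proof.
pose q (x : 'rV[R]_d.+1) := \sum_(i < d.+1) x ord0 i ^+ 2.
have -> : S = q @^-1` [set 1].
  apply/seteqP; split=> x; rewrite /sphere /enorm /= /q.
    move=> h; rewrite -(sqr_sqrtr (sumr_ge0 _ _)) ?h ?expr1n // => i _.
    exact: sqr_ge0.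
  by move=> ->; rewrite sqrtr1.
rewrite -[_ @^-1` _]setTI; apply: continuous_borel_measurable => //.
apply: continuous_sum => i x; 
apply: (@continuous_comp _ _ _ (fun y : 'rV[R]_d.+1 => y ord0 i)
  (fun t : R => t ^+ 2)); [exact: coord_continuous|exact: exprn_continuous].
Qed.

Lemma sphere_coord_le1 (x : 'rV[R]_d.+1) i : S x -> `|x ord0 i| <= 1.
Proof.
rewrite /sphere /enorm /= => h.
rewrite -h -sqrtr_sqr ler_wsqrtr // (bigD1 i) //= lerDl sumr_ge0 // => j _.
exact: sqr_ge0.
Qed.

Lemma integrable_sphere (f : 'rV[R]_d.+1 -> R) (M : R) : continuous f ->
  (forall x, S x -> `|f x| <= M) -> sigma.-integrable (S : set E) (EFin \o f).
Proof.
move=> cf fM; apply: measurable_bounded_integrable.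
- exact: measurable_sphere.
- exact: (eq_ind_r (fun y => (y < +oo)%E) (ltry (1 : R)) hsigma.1).
- by apply: measurable_funTS; exact: continuous_borel_measurable.
- exists M; split; first exact: num_real.
  by move=> N MN x Sx; apply: le_trans (fM x Sx) (ltW MN).
Qed.

Lemma enorm_rotation (Q : 'M[R]_d.+1) (x : 'rV[R]_d.+1) :
  Q *m Q^T = 1%:M -> enorm (x *m Q) = enorm x.
Proof.
move=> QQ; rewrite /enorm; congr Num.sqrt.
have H (y : 'rV[R]_d.+1) : \sum_i y ord0 i ^+ 2 = (y *m y^T) ord0 ord0.
  by rewrite mxE; apply: eq_bigr => i _; rewrite mxE.
by rewrite !H trmx_mul mulmxA -(mulmxA x) QQ mulmx1.
Qed.

(** Invariance says that the image of [sigma] under the orthogonal map is [sigma] itself, and the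
    sphere is its own preimage. The bound [M] provides the integrability required by the change of
    variables. *)
Lemma Rintegral_rotation (Q : 'M[R]_d.+1) (f : 'rV[R]_d.+1 -> R) (M : R) :
  Q *m Q^T = 1%:M -> continuous f -> (forall x, S x -> `|f x| <= M) ->
  \int[sigma]_(x in (S : set E)) f (x *m Q) =
  \int[sigma]_(x in (S : set E)) f x.
Proof.
move=> QQ cf fM.
have mQ := measurable_rotation Q.
have SQ : (rot Q : E -> E) @^-1` S = S.
  by apply/seteqP; split=> x; rewrite /sphere /= enorm_rotation.
rewrite /Rintegral; congr fine.
transitivity
  (\int[pushforward sigma (rot Q : E -> E)]_(x in (S : set E)) (f x)%:E)%E.
  rewrite integral_pushforward //=.
  - by rewrite SQ.
  - by apply/measurable_EFinP; exact: continuous_borel_measurable.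
  - rewrite SQ; apply: (@integrable_sphere (f \o rot Q) M).
      move=> x; apply: continuous_comp; last exact: cf.
      exact: continuous_rotation.
    by move=> x Sx; apply: fM; rewrite /sphere /= enorm_rotation.
  - exact: measurable_sphere.
apply: eq_measure_integral => A mA _.
exact: hsigma.2.
Qed.

(** The diagonal is -1 at [i] and 1 elsewhere: the reflection that flips coordinate [i]. *)
Lemma reflection_orthogonal (i : 'I_d.+1) :
  let Q : 'M[R]_d.+1 := diag_mx (\row_j (-1) ^+ (j == i)) in Q *m Q^T = 1%:M.
Proof.
move=> Q; rewrite /Q tr_diag_mx mulmx_diag -diag_const_mx; congr diag_mx.
by apply/rowP => j; rewrite !mxE -signr_addb addbb.
Qed.

Lemma reflectE (i j : 'I_d.+1) (x : 'rV[R]_d.+1) :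
  (x *m diag_mx (\row_j (-1) ^+ (j == i))) ord0 j = (-1) ^+ (j == i) * x ord0 j.
Proof. by rewrite mul_mx_diag !mxE mulrC. Qed.

Let eq_opp0 (a : R) : a = - a -> a = 0.
Proof. by lra. Qed.

Lemma sphere_moment1 (i : 'I_d.+1) :
  \int[sigma]_(x in (S : set E)) (x : 'rV[R]_d.+1) ord0 i = 0.
Proof.
have ci : continuous (fun x : 'rV[R]_d.+1 => x ord0 i).
  exact: coord_continuous.
apply: eq_opp0.
rewrite -[LHS](Rintegral_rotation _ _ 1 (reflection_orthogonal i)) //;
  last by move=> x; exact: sphere_coord_le1.
under eq_Rintegral do rewrite reflectE eqxx.
rewrite RintegralZl ?mulN1r //; first exact: measurable_sphere.
by apply: (integrable_sphere _ 1) => // x; exact: sphere_coord_le1.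
Qed.

Lemma continuous_coordM i j :
  continuous (fun x : 'rV[R]_d.+1 => x ord0 i * x ord0 j).
Proof. by move=> x; apply: continuousM; exact: coord_continuous. Qed.

Lemma sphere_coordM_le1 i j (x : 'rV[R]_d.+1) :
  S x -> `|x ord0 i * x ord0 j| <= 1.
Proof.
by move=> Sx; rewrite normrM mulr_ile1 // sphere_coord_le1.
Qed.

Lemma integrable_coordM i j : sigma.-integrable (S : set E)
  (EFin \o (fun x : 'rV[R]_d.+1 => x ord0 i * x ord0 j)).
Proof.
apply: (integrable_sphere _ 1); first exact: continuous_coordM.
exact: sphere_coordM_le1.
Qed.

(** Flipping coordinate [i] leaves coordinate [j] fixed, so the integral equals its own opposite. *)
Lemma sphere_moment2_neq (i j : 'I_d.+1) : i != j ->
  \int[sigma]_(x in (S : set E))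
    ((x : 'rV[R]_d.+1) ord0 i * (x : 'rV[R]_d.+1) ord0 j) = 0.
Proof.
move=> ij; apply: eq_opp0.
rewrite -[LHS](Rintegral_rotation _ (fun x => x ord0 i * x ord0 j) 1
  (reflection_orthogonal i)); last 2 first.
- exact: continuous_coordM.
- exact: sphere_coordM_le1.
under eq_Rintegral do rewrite !reflectE eqxx eq_sym (negbTE ij) mul1r -mulrA.
rewrite RintegralZl ?mulN1r //; first exact: measurable_sphere.
exact: integrable_coordM.
Qed.

Lemma Rintegral_sphere1 (c : R) : \int[sigma]_(x in (S : set E)) c = c.
Proof.
rewrite Rintegral_cst; last exact: measurable_sphere.
by rewrite -[RHS]mulr1; congr (_ * _); exact: (congr1 fine hsigma.1).
Qed.

Lemma tperm_orthogonal (i j : 'I_d.+1) :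
  let Q : 'M[R]_d.+1 := tperm_mx i j in Q *m Q^T = 1%:M.
Proof. by move=> Q; rewrite /Q tr_tperm_mx -perm_mxM perm.tperm2 perm_mx1. Qed.

Lemma sphere_moment2_eq (i j : 'I_d.+1) :
  \int[sigma]_(x in (S : set E))
    ((x : 'rV[R]_d.+1) ord0 i * (x : 'rV[R]_d.+1) ord0 i) =
  \int[sigma]_(x in (S : set E))
    ((x : 'rV[R]_d.+1) ord0 j * (x : 'rV[R]_d.+1) ord0 j).
Proof.
rewrite -[LHS](Rintegral_rotation _ (fun x => x ord0 i * x ord0 i) 1
  (tperm_orthogonal i j)); last 2 first.
- exact: continuous_coordM.
- exact: sphere_coordM_le1.
by under eq_Rintegral do rewrite -xcolE !mxE perm.tpermL.
Qed.

(** All second moments agree, and together they integrate the squared norm, which is 1 on the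
    sphere. *)
Lemma sphere_moment2 (i : 'I_d.+1) :
  \int[sigma]_(x in (S : set E))
    ((x : 'rV[R]_d.+1) ord0 i * (x : 'rV[R]_d.+1) ord0 i) = d.+1%:R^-1.
Proof.
set J := LHS.
have : \int[sigma]_(x in (S : set E))
    (\sum_j (x : 'rV[R]_d.+1) ord0 j * (x : 'rV[R]_d.+1) ord0 j) = 1.
  rewrite -[RHS]Rintegral_sphere1; apply: eq_Rintegral => x.
  rewrite inE /sphere /enorm /= => h.
  rewrite -[RHS](expr1n _ 2) -h sqr_sqrtr //.
  by apply: sumr_ge0 => j _; exact: sqr_ge0.
rewrite Rintegral_sum; last 2 first.
- exact: measurable_sphere.
- by move=> j; exact: integrable_coordM.
under eq_bigr do rewrite (sphere_moment2_eq _ i).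
rewrite sumr_const card_ord -/J -[LHS]mulr_natl => h.
by apply: (mulfI (x := d.+1%:R)); rewrite ?pnatr_eq0 // h divff // pnatr_eq0.
Qed.
End sphere_moments.

(** * Positivity of integrals, Lipschitz bounds and shifts on the line *)

Section segment_integrals.
Context {R : realType}.
Notation mu := (@lebesgue_measure R).
Implicit Types (f : R -> R) (a b : R).

(** By continuity [f] exceeds [f u0 / 2] on a short interval to the right of [u0], and the remaining
    pieces contribute a nonnegative amount. *)
Lemma Rintegral_segment_gt0 f a b u0 : continuous f -> (forall u, 0 <= f u) ->
  a <= u0 < b -> 0 < f u0 -> 0 < \int[mu]_(u in `[a, b]) f u.
Proof.
move=> cf f0 /andP[au0 u0b] fu0.
have /cvgrPdist_lt/(_ (f u0 / 2))/(_ _)/nbhs_ballP[|d d0 /= hd] := cf u0.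
  by rewrite divr_gt0.
(* The term [d / 2] keeps the closed interval inside the open ball, and [b - u0] keeps it below
   [b]. *)
pose v := u0 + Order.min (d / 2) (b - u0).
have m0 : 0 < Order.min (d / 2) (b - u0).
  by rewrite lt_min divr_gt0 //= subr_gt0.
have u0v : u0 < v by rewrite ltrDl.
have vb : v <= b by rewrite /v -lerBrDl ge_min lexx orbT.
have I c e := continuous_integrable_segment f c e cf.
rewrite (Rintegral_cat f a u0 b) ?(ltW u0b) //.
rewrite (Rintegral_cat f u0 v b) ?(ltW u0v) //.
apply: ltr_wpDl; first by apply: Rintegral_ge0.
apply: ltr_wpDr; first by apply: Rintegral_ge0.
have : \int[mu]_(u in `[u0, v]) (f u0 / 2) <= \int[mu]_(u in `[u0, v]) f u.
  apply: le_Rintegral => //.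
    by apply: continuous_integrable_segment; exact: cst_continuous.
  move=> u; rewrite /= in_itv /= => /andP[u0u uv].
  have : ball u0 d u.
    rewrite /ball /= distrC ger0_norm ?subr_ge0 // ltrBlDl.
    apply: le_lt_trans uv _; rewrite /v ltrD2l.
    by rewrite gt_min; apply/orP; left; rewrite ltr_pdivrMr // ltr_pMr ?ltr1n.
  move=> /hd; rewrite ltr_norml => /andP[_ h]; lra.
apply: lt_le_trans; rewrite Rintegral_cst // mulr_gt0 ?divr_gt0 //.
rewrite /= lebesgue_measure_itv /= lte_fin u0v -EFinB /=.
by rewrite subr_gt0.
Qed.

(** Mean value theorem, with the maximum of the absolute value of [df] on the compact segment as
    constant. *)
Lemma C1_lipschitz_segment f (df : R -> R) a b : a <= b ->
  (forall u : R, is_derive u 1 f (df u)) -> continuous df ->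
  exists M, forall s t, s \in `[a, b] -> t \in `[a, b] ->
    `|f s - f t| <= M * `|s - t|.
Proof.
move=> ab fd cdf.
have cn : {within `[a, b], continuous (fun u => `|df u|)}.
  apply: continuous_subspaceT => u.
  by apply: continuous_comp; [exact: cdf|exact: norm_continuous].
have [c _ hc] := EVT_max ab cn.
exists `|df c|.
suff H s t : s <= t -> s \in `[a, b] -> t \in `[a, b] ->
    `|f s - f t| <= `|df c| * `|s - t|.
  move=> s t sI tI; have [st|ts] := leP s t; first exact: H.
  by rewrite distrC (distrC s); apply: H => //; exact: ltW.
move=> st sI tI; rewrite distrC (distrC s).
have [|e eI ->] := @MVT_segment R f df s t st (fun u _ => fd u).
  apply: continuous_subspaceT => u; apply: differentiable_continuous.
  by apply/derivable1_diffP; exact: ex_derive.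
rewrite normrM ler_wpM2r //; apply: hc.
move: sI tI eI; rewrite !in_itv /= => /andP[h1 h2] /andP[h3 h4] /andP[h5 h6].
by apply/andP; split; lra.
Qed.

Lemma derive1_shift f a c : (forall u, f (u + a) = c * f u) ->
  (forall u : R, derivable f u 1) ->
  forall u, derive1 f (u + a) = c * derive1 f u.
Proof.
move=> fa fd u.
have -> : derive1 f (u + a) = derive1 (fun v => f (v + a)) u.
  by rewrite /derive1 /=; under eq_fun do rewrite addrA.
have -> : (fun v => f (v + a)) = (fun v => c * f v) by exact/funext.
rewrite !derive1E; exact: (@deriveZ R R R f c u 1 (fd u)).
Qed.

(** This follows the layout of the curve: cosine coordinates at even numbers, sine coordinates at
    odd ones, the last coordinate alone. *)
Lemma sum_pairs (F : nat -> R) k :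
  \sum_(i < (2 * k).+1) F i =
  \sum_(j < k) (F (2 * j)%N + F (2 * j).+1) + F (2 * k)%N.
Proof.
rewrite big_ord_recr /=; congr (_ + _).
elim: k => [|k ih]; first by rewrite !big_ord0.
by rewrite mulnSr addn2 !big_ord_recr /= ih addrA.
Qed.

End segment_integrals.

(** * Moments of the curve weighted by its speed *)

Section twisted_curve_moments.
Context {R : realType} {k : nat}.
Notation mu := (@lebesgue_measure R).
Variables (x : 'I_k -> R -> R) (z : R -> R).
Hypothesis hxC1 : forall j, continuously_differentiable (x j).
Hypothesis hxper : forall j, periodic (x j) (pi / k.+1%:R).
Hypothesis hzC1 : continuously_differentiable z.
Hypothesis hzanti : antiperiodic z (pi / k.+1%:R).
Hypothesis hsphere :
  forall theta, \sum_(j < k) x j theta ^+ 2 + z theta ^+ 2 = 1.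

Notation a := (pi / k.+1%:R : R).

Definition speed (u : R) : R :=
  Num.sqrt (\sum_(l < k) (derive1 (x l) u ^+ 2 + l.+1%:R ^+ 2 * x l u ^+ 2)
            + derive1 z u ^+ 2).

Hypothesis hint : forall j,
  \int[mu]_(u in `[0, 2 * pi])
    ((x j u ^+ 2 - 2 / (2 * k + 1)%:R) * speed u) = 0.

(* The coordinate number [n] of the curve is
   [amp n u * trig (odd n) ((freq n)%:R * u)] and its amplitude satisfies
   [amp n (u + a) = sgn n * amp n u]; the last coordinate has frequency 0. *)
Definition amp (n : nat) : R -> R := if insub n./2 is Some j then x j else z.
Definition freq (n : nat) : nat := if (n./2 < k)%N then n./2.+1 else 0%N.
Definition sgn (n : nat) : R := if (n./2 < k)%N then 1 else -1.
Definition trig (b : bool) : R -> R := if b then sin else cos.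
Definition dtrig (b : bool) : R -> R := if b then cos else (fun t => - sin t).

Definition coord (n : nat) (u : R) : R :=
  amp n u * trig (odd n) ((freq n)%:R * u).
Definition dcoord (n : nat) (u : R) : R :=
  derive1 (amp n) u * trig (odd n) ((freq n)%:R * u) +
  amp n u * ((freq n)%:R * dtrig (odd n) ((freq n)%:R * u)).

Lemma half_lt n : (n < 2 * k)%N -> (n./2 < k)%N.
Proof. by rewrite mul2n ltn_half_double. Qed.

Lemma half_odd m : (2 * m).+1./2 = m.
Proof. by rewrite mul2n -[RHS](half_bit_double m true). Qed.

Lemma amp_even (j : 'I_k) : amp (2 * j) = x j.
Proof. by rewrite /amp mul2n doubleK valK. Qed.

Lemma amp_odd (j : 'I_k) : amp (2 * j).+1 = x j.
Proof. by rewrite /amp half_odd valK. Qed.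

Lemma amp_last : amp (2 * k) = z.
Proof. by rewrite /amp mul2n doubleK insubN ?ltnn. Qed.

Lemma freq_even (j : 'I_k) : freq (2 * j) = j.+1.
Proof. by rewrite /freq mul2n doubleK ltn_ord. Qed.

Lemma freq_odd (j : 'I_k) : freq (2 * j).+1 = j.+1.
Proof. by rewrite /freq half_odd ltn_ord. Qed.

Lemma freq_last : freq (2 * k) = 0%N.
Proof. by rewrite /freq mul2n doubleK ltnn. Qed.

Lemma half_ge (i : 'I_(2 * k).+1) : ~~ (i./2 < k)%N -> i = (2 * k)%N :> nat.
Proof.
move=> ik; have := ltn_ord i; rewrite ltnS => ik2.
by apply/eqP; rewrite eqn_leq ik2 /= leqNgt; apply: contra ik; exact: half_lt.
Qed.

Lemma twisted_curveE u (i : 'I_(2 * k).+1) :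
  twisted_curve x z u ord0 i = coord i u.
Proof.
rewrite mxE /coord /amp /freq; case: insubP => [j jk <-|ik].
  by rewrite (ltn_ord j) /trig; case: odd.
rewrite (negbTE ik) mul0r (half_ge _ ik).
by rewrite mul2n odd_double /trig cos0 mulr1.
Qed.

Lemma amp_C1 n : continuously_differentiable (amp n).
Proof. by rewrite /amp; case: insubP. Qed.

Lemma C1_continuous (f : R -> R) :
  continuously_differentiable f -> continuous f.
Proof.
by move=> [fd _] u; apply/differentiable_continuous/derivable1_diffP; exact: fd.
Qed.

Lemma trig_continuous b (c : R) : continuous (fun u : R => trig b (c * u)).
Proof.
move=> u; apply: (@continuous_comp _ _ _ (fun u => c * u) (trig b)).
  exact: continuous_mulr_cst.
by case: b; [exact: continuous_sin|exact: continuous_cos].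
Qed.

Lemma dtrig_continuous b (c : R) : continuous (fun u : R => dtrig b (c * u)).
Proof.
move=> u; apply: (@continuous_comp _ _ _ (fun u => c * u) (dtrig b)).
  exact: continuous_mulr_cst.
case: b; first exact: continuous_cos.
by apply: continuousN; exact: continuous_sin.
Qed.

Lemma twisted_coord_continuous n : continuous (coord n).
Proof.
apply: continuous_fun_mul; first exact/C1_continuous/amp_C1.
exact: trig_continuous.
Qed.

Lemma dcoord_continuous n : continuous (dcoord n).
Proof.
apply: continuous_fun_add; apply: continuous_fun_mul.
- exact: (amp_C1 n).2.
- exact: trig_continuous.
- exact/C1_continuous/amp_C1.
- by apply: continuous_fun_mul; [exact: cst_continuous|exact: dtrig_continuous].
Qed.

Lemma is_derive_trig b (u : R) : is_derive u 1 (trig b) (dtrig b u).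
Proof.
by case: b; [exact: is_derive_sin|exact: is_derive_cos].
Qed.

Lemma is_derive_coord n (u : R) : is_derive u 1 (coord n) (dcoord n u).
Proof.
have da : is_derive u 1 (amp n) (derive1 (amp n) u).
  by rewrite derive1E; apply/derivableP; exact: (amp_C1 n).1.
have dl : is_derive u 1 (fun u : R => (freq n)%:R * u) (freq n)%:R.
  by apply: is_derive_eq; rewrite /GRing.scale /= mulr1.
have dt : is_derive u 1 (fun u => trig (odd n) ((freq n)%:R * u))
    ((freq n)%:R * dtrig (odd n) ((freq n)%:R * u)).
  rewrite mulrC; apply: (@is_derive1_comp _ (trig (odd n))
    (fun u => (freq n)%:R * u)); exact: is_derive_trig.
apply: (is_derive_eq (is_deriveM da dt)).
by rewrite /dcoord addrC /GRing.scale /=; ring.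
Qed.

(** In each cosine-sine pair the derivative has radial part [derive1 (x j) u] and tangential part
    [j.+1%:R * x j u], which are orthogonal, so the cross terms cancel. The last coordinate
    contributes its derivative alone. *)
Lemma enorm_derive1 u : enorm (derive1 (twisted_curve x z) u) = speed u.
Proof.
have E i : (fun u => twisted_curve x z u ord0 i) = coord i.
  by apply/funext => v; rewrite twisted_curveE.
have D : derivable (twisted_curve x z) u 1.
  apply/derivable_mxP => i j; rewrite (ord1 i) E.
  by have ? := is_derive_coord j u; exact: ex_derive.
rewrite /enorm /speed; congr Num.sqrt.
transitivity (\sum_(i < (2 * k).+1) dcoord i u ^+ 2).
  apply: eq_bigr => i _; rewrite derive1E derive_mx // mxE E.
  by have ? := is_derive_coord i u; rewrite derive_val.
rewrite (sum_pairs (fun n => dcoord n u ^+ 2)); congr (_ + _).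
  apply: eq_bigr => j _.
  rewrite /dcoord amp_even amp_odd freq_even freq_odd /=.
  rewrite mul2n odd_double /=.
  set t := j.+1%:R * u.
  transitivity ((derive1 (x j) u ^+ 2 + j.+1%:R ^+ 2 * x j u ^+ 2) *
    (cos t ^+ 2 + sin t ^+ 2)); first by ring.
  by rewrite cos2Dsin2 mulr1.
rewrite /dcoord amp_last freq_last mul2n odd_double /= !mul0r cos0.
by rewrite mulr0 addr0 mulr1.
Qed.

Lemma pi_step : 2 * pi = a *+ (2 * k.+1) :> R.
Proof. by rewrite -[RHS]mulr_natr natrM mulrCA divfK ?pnatr_eq0. Qed.

Lemma step_gt0 : 0 < a.
Proof. by rewrite divr_gt0 ?pi_gt0. Qed.

(** A full turn consists of an even number of steps [a], so the signs cancel. *)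
Lemma periodic_of_shift (f : R -> R) (e : R) :
  (forall u, f (u + a) = e * f u) -> e ^+ 2 = 1 -> periodic f (2 * pi).
Proof.
move=> fa e2 u; rewrite pi_step.
have H n v : f (v + a *+ n) = e ^+ n * f v.
  elim: n => [|n ih]; first by rewrite mulr0n addr0 expr0 mul1r.
  by rewrite mulrSr addrA fa ih exprS mulrA.
by rewrite H exprM e2 expr1n mul1r.
Qed.

Lemma sgn_sqr n : sgn n ^+ 2 = 1.
Proof. by rewrite /sgn; case: ifP; rewrite ?sqrrN expr1n. Qed.

Lemma amp_shift n u : amp n (u + a) = sgn n * amp n u.
Proof.
rewrite /amp /sgn; case: insubP => [j jk <-|/negbTE ->].
  by rewrite ltn_ord mul1r hxper.
by rewrite mulN1r hzanti.
Qed.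

Lemma speed_continuous : continuous speed.
Proof.
move=> u; apply: (@continuous_comp _ _ _
  (fun v => \sum_(l < k) (derive1 (x l) v ^+ 2 + l.+1%:R ^+ 2 * x l v ^+ 2) +
            derive1 z v ^+ 2) (@Num.sqrt R)); last first.
  exact: sqrt_continuous.
apply: continuous_fun_add; last exact/continuous_fun_sqr/hzC1.2.
apply: continuous_sum => l; apply: continuous_fun_add.
  exact/continuous_fun_sqr/(hxC1 l).2.
apply: continuous_fun_mul; first exact: cst_continuous.
exact/continuous_fun_sqr/C1_continuous.
Qed.

(** Derivatives inherit the shift relations of the functions, and squaring removes the sign coming
    from [z]. *)
Lemma speed_shift u : speed (u + a) = speed u.
Proof.
rewrite /speed; congr Num.sqrt; congr (_ + _).
  apply: eq_bigr => l _; rewrite hxper.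
  rewrite (derive1_shift (x l) a 1) ?mul1r // => [v|].
    by rewrite mul1r hxper.
  exact: (hxC1 l).1.
rewrite (derive1_shift z a (-1)) ?mulN1r ?sqrrN // => [v|].
  by rewrite mulN1r hzanti.
exact: hzC1.1.
Qed.

Lemma speed_ge0 u : 0 <= speed u.
Proof. exact: sqrtr_ge0. Qed.

Lemma cos_natmul (m n : nat) : cos ((m%:R - n%:R) * (2 * pi)) = 1 :> R.
Proof.
have H (b : bool) j : trig b (j%:R * (2 * pi)) = trig b 0.
  have p : periodic (trig b) (2 * pi).
    rewrite mulr_natl; case: b; [exact: sinD2pi|exact: cosD2pi].
  by rewrite mulr_natl -[X in trig b X]add0r periodicn.
rewrite mulrBl cosB -[cos]/(trig false) -[sin]/(trig true) !H /= cos0 sin0.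
by ring.
Qed.

(** Frequencies are integers, written as differences of naturals so that negative ones are covered;
    this gives the closing condition on a full turn in [Rintegral_trig_eq0]. *)
Lemma Rintegral_trig_freq0 f (e : R) b m n : continuous f ->
  (forall u, f (u + a) = e * f u) -> e ^+ 2 = 1 ->
  cos ((m%:R - n%:R) * a) != e ->
  \int[mu]_(u in `[0, 2 * pi]) (f u * trig b ((m%:R - n%:R) * u)) = 0.
Proof.
move=> cf fa e2 ce.
have pi2 : 0 <= 2 * pi :> R by rewrite mulr_ge0 ?pi_ge0.
have [hc hs] := Rintegral_trig_eq0 f (2 * pi) a (m%:R - n%:R) e pi2
  (ltW step_gt0) cf (periodic_of_shift f e fa e2) (cos_natmul m n) fa e2 ce.
by case: b.
Qed.

(** The four product-to-sum formulas at once: the result involves sines exactly when one factor is a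
    sine and the other a cosine, and the powers of -1 carry the signs. *)
Lemma trigM b c s t : trig b s * trig c t =
  2^-1 * ((-1) ^+ (c && ~~ b) * trig (b (+) c) (s - t) +
          (-1) ^+ (b && c) * trig (b (+) c) (s + t)) :> R.
Proof. by case: b; case: c; rewrite /= ?(sinD, cosD, sinN, cosN); field. Qed.

Lemma freq_le n : (freq n <= k)%N.
Proof. by rewrite /freq; case: ifP. Qed.

Lemma ltr_dist_nat (m n p : nat) : (m < p)%N -> (n < p)%N ->
  `|m%:R - n%:R| < p%:R :> R.
Proof.
move=> mp np; rewrite ltr_norml ltrNl opprB !ltrBlDr -!natrD !ltr_nat.
by rewrite !ltn_addr.
Qed.

(** The frequency is nonzero and at most 2k in absolute value, hence below 2(k + 1), so the angle is
    nonzero and below 2 pi in absolute value. *)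
Lemma cos_step_neq1 m n : m != n -> (m <= 2 * k)%N -> (n <= 2 * k)%N ->
  cos ((m%:R - n%:R) * a) != 1.
Proof.
move=> mn mk nk; apply: cos_neq1.
  by apply: mulf_neq0; [rewrite subr_eq0 eqr_nat|exact: lt0r_neq0 step_gt0].
have -> : pi *+ 2 = (2 * k.+1)%:R * a :> R.
  by rewrite -[LHS]mulr_natl pi_step [RHS]mulr_natl.
rewrite normrM (gtr0_norm step_gt0).
rewrite ltr_pM2r ?step_gt0 // ltr_dist_nat // mulnS add2n ltnS.
  exact: leq_trans mk _.
exact: leq_trans nk _.
Qed.

(** The frequency is at most k in absolute value, hence below k + 1, and the angle stays below pi in
    absolute value. *)
Lemma cos_step_neqN1 m n : (m <= k)%N -> (n <= k)%N ->
  cos ((m%:R - n%:R) * a) != -1.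
Proof.
move=> mk nk; apply: cos_neqN1.
rewrite normrM (gtr0_norm step_gt0) mulrA ltr_pdivrMr // mulrC.
by rewrite ltr_pM2l ?pi_gt0 // ltr_dist_nat.
Qed.

Definition amp2 i j (u : R) := amp i u * amp j u * speed u.

Lemma amp2_continuous i j : continuous (amp2 i j).
Proof.
apply: continuous_fun_mul; last exact: speed_continuous.
by apply: continuous_fun_mul; exact/C1_continuous/amp_C1.
Qed.

Lemma amp2_shift i j u : amp2 i j (u + a) = sgn i * sgn j * amp2 i j u.
Proof. by rewrite /amp2 !amp_shift speed_shift; ring. Qed.

Lemma sgn2_sqr i j : (sgn i * sgn j) ^+ 2 = 1.
Proof. by rewrite exprMn !sgn_sqr mulr1. Qed.

(* Product-to-sum formula: only the frequencies [freq i - freq j] and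
   [freq i + freq j] occur, and the latter never resonates. *)
Lemma Rintegral_coordM i j : (i./2 < k)%N || (j./2 < k)%N ->
  \int[mu]_(u in `[0, 2 * pi]) (coord i u * coord j u * speed u) =
  2^-1 * (-1) ^+ (odd j && ~~ odd i) *
  \int[mu]_(u in `[0, 2 * pi]) (amp2 i j u *
    trig (odd i (+) odd j) (((freq i)%:R - (freq j)%:R) * u)).
Proof.
move=> ij; set b := odd i (+) odd j.
pose r := (freq i + freq j)%:R - 0%:R : R.
have I s : mu.-integrable `[0, 2 * pi]
    (EFin \o (fun u => amp2 i j u * trig b (s * u))).
  apply: continuous_integrable_segment.
  by apply: continuous_fun_mul; [exact: amp2_continuous|exact: trig_continuous].
transitivity (\int[mu]_(u in `[0, 2 * pi])
    (2^-1 * (-1) ^+ (odd j && ~~ odd i) *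
       (amp2 i j u * trig b (((freq i)%:R - (freq j)%:R) * u)) +
     2^-1 * (-1) ^+ (odd i && odd j) * (amp2 i j u * trig b (r * u)))).
  apply: eq_Rintegral => u _; rewrite /coord.
  transitivity (amp2 i j u * (trig (odd i) ((freq i)%:R * u) *
                            trig (odd j) ((freq j)%:R * u))).
    by rewrite /amp2; ring.
  by rewrite trigM -/b /r subr0 natrD [in RHS]mulrBl [in RHS]mulrDl; ring.
rewrite RintegralD //; try by apply: integrable_scale.
rewrite RintegralZl // RintegralZl //.
rewrite [X in _ + _ * X](Rintegral_trig_freq0 _ (sgn i * sgn j)).
- by rewrite mulr0 addr0.
- exact: amp2_continuous.
- exact: amp2_shift.
- exact: sgn2_sqr.
have fl := freq_le.
(* For two periodic amplitudes the sign is 1 and the sum of the frequencies lies between 2 and 2k.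
   If exactly one is the last coordinate, the sign is -1 and the sum is at most k. Hypothesis [ij]
   excludes the remaining case. *)
move: ij (fl i) (fl j); rewrite /sgn /freq.
case: ifP => ik; case: ifP => jk //= _ fi fj.
- by rewrite mulr1; apply: cos_step_neq1 => //; rewrite mul2n -addnn leq_add.
- by rewrite mul1r; apply: cos_step_neqN1 => //; rewrite addn0.
- by rewrite mulr1; apply: cos_step_neqN1.
Qed.

Definition len : R := \int[mu]_(u in `[0, 2 * pi]) speed u.

Lemma coord_moment1 i :
  \int[mu]_(u in `[0, 2 * pi]) (coord i u * speed u) = 0.
Proof.
transitivity (\int[mu]_(u in `[0, 2 * pi])
    (amp i u * speed u * trig (odd i) (((freq i)%:R - 0%:R) * u))).
  by apply: eq_Rintegral => u _; rewrite subr0 /coord mulrAC.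
apply: (Rintegral_trig_freq0 _ (sgn i)).
- apply: continuous_fun_mul; first exact/C1_continuous/amp_C1.
  exact: speed_continuous.
- by move=> u; rewrite amp_shift speed_shift mulrA.
- exact: sgn_sqr.
(* A periodic amplitude has sign 1 and a frequency from 1 to k; the last coordinate has sign -1 and
   frequency 0. *)
have := freq_le i; rewrite /sgn /freq; case: ifP => ik // fi.
- apply: cos_step_neq1 => //.
  by rewrite (leq_trans fi) // leq_pmull.
- exact: cos_step_neqN1.
Qed.

Lemma coord_moment2_neq (i j : 'I_(2 * k).+1) : i != j ->
  \int[mu]_(u in `[0, 2 * pi]) (coord i u * coord j u * speed u) = 0.
Proof.
move=> ij.
have ijk : (i./2 < k)%N || (j./2 < k)%N.
  apply: contraNT ij; rewrite negb_or => /andP[/half_ge iE /half_ge jE].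
  by apply/eqP/val_inj; rewrite /= iE jE.
rewrite Rintegral_coordM //; have [fij|fij] := eqVneq (freq i) (freq j).
  (* Distinct coordinates of equal frequency are the cosine and the sine of one pair, so the
     remaining factor is the sine of 0. *)
  have hij : i./2 = j./2.
    by move: fij ijk; rewrite /freq; case: ifP => _; case: ifP => _ // [].
  have oij : odd i (+) odd j.
    rewrite -negb_eqb; apply: contra ij => /eqP o; apply/eqP/val_inj => /=.
    by rewrite -(odd_double_half i) -(odd_double_half j) o hij.
  rewrite oij fij subrr; under eq_Rintegral do rewrite mul0r /trig sin0 mulr0.
  by rewrite Rintegral_cst // mul0r mulr0.
rewrite (Rintegral_trig_freq0 _ (sgn i * sgn j)) ?mulr0 //.
- exact: amp2_continuous.
- exact: amp2_shift.
- exact: sgn2_sqr.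
have fl := freq_le.
(* For distinct frequencies the difference is nonzero and at most k in absolute value, which rules
   out resonance for either sign. *)
move: ijk fij (fl i) (fl j); rewrite /sgn /freq.
case: ifP => ik; case: ifP => jk //= _ fij fi fj.
- rewrite mulr1; apply: cos_step_neq1;
    by rewrite ?(leq_trans _ (leq_pmull k _)).
- by rewrite mul1r; apply: cos_step_neqN1.
- by rewrite mulr1; apply: cos_step_neqN1.
Qed.

Lemma integrable_coord2 i j : mu.-integrable `[0, 2 * pi]
  (EFin \o (fun u => coord i u * coord j u * speed u)).
Proof.
apply: continuous_integrable_segment.
apply: continuous_fun_mul; last exact: speed_continuous.
by apply: continuous_fun_mul; exact: twisted_coord_continuous.
Qed.

(** The difference frequency is 0, which leaves half the integral of the squared amplitude against
    the speed; [hint] gives that integral as 2/(2k + 1) times [len]. *)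
Lemma coord_moment2_lt i : (i./2 < k)%N ->
  \int[mu]_(u in `[0, 2 * pi]) (coord i u * coord i u * speed u) =
  len / (2 * k).+1%:R.
Proof.
move=> ik; rewrite Rintegral_coordM ?ik // addbb andbN expr0 mulr1 subrr.
have ampE : amp i = x (Ordinal ik).
  rewrite /amp; case: insubP => [j _ ij|]; last by rewrite ik.
  by congr x; exact: val_inj.
under eq_Rintegral do rewrite mul0r /trig cos0 mulr1.
have I2 := continuous_integrable_segment _ 0 (2 * pi) (amp2_continuous i i).
have Is := continuous_integrable_segment _ 0 (2 * pi) speed_continuous.
have : \int[mu]_(u in `[0, 2 * pi]) amp2 i i u - 2 / (2 * k).+1%:R * len = 0.
  rewrite -[RHS](hint (Ordinal ik)) /len -RintegralZl // -RintegralB //.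
    apply: eq_Rintegral => u _.
    by rewrite /amp2 ampE addn1 mulrBl expr2.
  exact: integrable_scale.
by move=> /eqP; rewrite subr_eq0 => /eqP ->; field.
Qed.

Lemma sum_coord_sqr u : \sum_(i < (2 * k).+1) coord i u * coord i u = 1.
Proof.
rewrite -(hsphere u) (sum_pairs (fun n => coord n u * coord n u)).
congr (_ + _).
  apply: eq_bigr => j _; rewrite /coord amp_even amp_odd freq_even freq_odd /=.
  rewrite mul2n odd_double /=; set t := j.+1%:R * u.
  transitivity (x j u ^+ 2 * (cos t ^+ 2 + sin t ^+ 2)); first by ring.
  by rewrite cos2Dsin2 mulr1.
by rewrite /coord amp_last freq_last mul2n odd_double /= mul0r cos0 mulr1 expr2.
Qed.

(** For the last coordinate, the other 2k moments are subtracted from [len], the total given by the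
    equation of the sphere. *)
Lemma coord_moment2_eq (i : 'I_(2 * k).+1) :
  \int[mu]_(u in `[0, 2 * pi]) (coord i u * coord i u * speed u) =
  len / (2 * k).+1%:R.
Proof.
case: (ltnP i./2 k) => [|]; first exact: coord_moment2_lt.
rewrite leqNgt => /half_ge ->.
have : \sum_(i < (2 * k).+1)
    \int[mu]_(u in `[0, 2 * pi]) (coord i u * coord i u * speed u) = len.
  rewrite -Rintegral_sum //; last by move=> j; exact: integrable_coord2.
  by apply: eq_Rintegral => u _; rewrite -mulr_suml sum_coord_sqr mul1r.
rewrite big_ord_recr /=.
under eq_bigr => j _ do rewrite coord_moment2_lt ?half_lt //.
rewrite sumr_const card_ord -[_ *+ _]mulr_natr => h.
apply: (addrI (len / (2 * k).+1%:R * (2 * k)%:R)); rewrite h.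
by rewrite -[X in _ = _ + X]mulr1 -mulrDr natr1 divfK ?pnatr_eq0.
Qed.

(** Antiperiodicity makes [z] vanish at some [u0]. There the squares of the [x l] sum to 1 and their
    weights in the speed are at least 1, so the speed is positive. *)
Lemma len_gt0 : (0 < k)%N -> 0 < len.
Proof.
move=> k0.
have [u0 u0I zu0] : exists2 u0, u0 \in `[0, a] & z u0 = 0.
  apply: IVT; first exact/ltW/step_gt0.
    by apply: continuous_subspaceT; exact: C1_continuous.
  have -> : z a = - z 0 by rewrite -hzanti add0r.
  rewrite ge_min le_max.
  by have [z0|z0] := leP 0 (z 0);
    rewrite ?oppr_le0 ?oppr_ge0 ?z0 ?(ltW z0) ?orbT.
apply: (Rintegral_segment_gt0 _ _ _ u0).
- exact: speed_continuous.
- exact: speed_ge0.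
- move: u0I; rewrite in_itv /= => /andP[-> u0a] /=.
  apply: le_lt_trans u0a _; rewrite pi_step -[X in X < _]mulr1n.
  by rewrite ltr_pMn2l ?step_gt0 // mulnS.
rewrite /speed sqrtr_gt0; apply: lt_le_trans (ltr01) _.
rewrite -[leLHS](hsphere u0) zu0 expr0n addr0.
apply: ler_wpDr; first exact: sqr_ge0.
apply: ler_sum => l _; apply: ler_wpDl; first exact: sqr_ge0.
by rewrite -[leLHS]mul1r ler_wpM2r ?sqr_ge0 // -natrX ler1n expn_gt0.
Qed.

Lemma coord_period n : coord n (2 * pi) = coord n 0.
Proof.
have p := periodic_of_shift _ _ (amp_shift n) (sgn_sqr n) 0.
rewrite /coord -[in amp n _](add0r (2 * pi)) p; congr (_ * _).
have q : periodic (trig (odd n)) (2 * pi).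
  rewrite mulr_natl; case: odd; [exact: sinD2pi|exact: cosD2pi].
by rewrite mulr0 mulr_natl -[_ *+ _]add0r periodicn.
Qed.

Lemma twisted_curve_closed : lipschitz_closed_curve (twisted_curve x z).
Proof.
split.
- move=> u _; rewrite /sphere /enorm /=.
  under eq_bigr do rewrite twisted_curveE expr2.
  by rewrite sum_coord_sqr sqrtr1.
- have pi2 : 0 <= 2 * pi :> R by rewrite mulr_ge0 ?pi_ge0.
  have /choice[M hM] : forall i : 'I_(2 * k).+1, exists M : R, forall s t : R,
      s \in `[0, 2 * pi] -> t \in `[0, 2 * pi] ->
      `|coord i s - coord i t| <= M * `|s - t|.
    move=> i; apply: (C1_lipschitz_segment _ _ _ _ pi2 (is_derive_coord i)).
    exact: dcoord_continuous.
  (* Euclidean norm of the vector of Lipschitz constants of the coordinates. *)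
  exists (Num.sqrt (\sum_(i < (2 * k).+1) M i ^+ 2)) => s t sI tI.
  have sub (u : R) : u \in `[0, 2 * pi[ -> u \in `[0, 2 * pi].
    by rewrite !in_itv /= => /andP[-> /ltW].
  rewrite -[`|s - t|]sqrtr_sqr -sqrtrM; last first.
    by apply: sumr_ge0 => i _; exact: sqr_ge0.
  apply: ler_wsqrtr; rewrite mulr_suml; apply: ler_sum => i _.
  have -> : (twisted_curve x z s - twisted_curve x z t) ord0 i =
      coord i s - coord i t by rewrite -!twisted_curveE !mxE.
  rewrite -exprMn -[leLHS]real_normK ?num_real //.
  have h := hM i s t (sub s sI) (sub t tI).
  rewrite -[leRHS]real_normK ?num_real // ler_sqr ?nnegrE //.
  by rewrite normrM (le_trans h) // ler_wpM2r // ler_norm.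
apply: (@cvg_mx_coord _ _ _ (at_left_proper_filter _)) => i j.
(* The value at 0 is replaced by the equal value at 2 pi, so that the left limit becomes plain
   continuity. *)
rewrite (ord1 i) twisted_curveE -coord_period.
under eq_fun do rewrite twisted_curveE.
by apply: cvg_at_left_filter; exact: twisted_coord_continuous.
Qed.

End twisted_curve_moments.

(** * Monomials of degree at most two and the design identity *)

Lemma mpoly_monomial_le2 (n : nat) (m : mpoly.multinom n) :
  (mpoly.mdeg m < 3)%N ->
  [\/ m = mpoly.mnm0, exists i, m = mpoly.mnm1 i |
      exists i j, m = mpoly.mnm_add (mpoly.mnm1 i) (mpoly.mnm1 j)].
Proof.
case E : (mpoly.mdeg m) => [|[|[|//]]] _.
- by constructor 1; apply/eqP; rewrite -mpoly.mdeg_eq0 E.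
- constructor 2.
  have /mpoly.mdeg1P[i /eqP ->] : mpoly.mdeg m == 1%N by rewrite E.
  by exists i.
constructor 3.
(* Some variable has a nonzero exponent; dividing by it leaves a monomial of degree 1. *)
have [i mi] : exists i, m i != 0%N.
  apply/existsP; rewrite -negb_forall; apply: contra_eqN E => /forallP m0.
  by rewrite mpoly.mdegE big1 // => i _; exact/eqP/m0.
have le : mpoly.lem (mpoly.mnm1 i) m.
  by rewrite mpoly.lep1mP.
have := congr1 (@mpoly.mdeg n) (mpoly.submK le).
rewrite mpoly.mdegD mpoly.mdeg1 E addn1 => -[] /eqP /mpoly.mdeg1P[j /eqP mj].
by exists j, i; rewrite -mj mpoly.submK.
Qed.

Lemma prod_mnm1 (R : comNzRingType) (n : nat) (v : 'I_n -> R) (i : 'I_n) :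
  \prod_j v j ^+ (mpoly.mnm1 i) j = v i.
Proof. by rewrite -mpoly.mevalX mpoly.mevalXU. Qed.

Lemma prod_mnm2 (R : comNzRingType) (n : nat) (v : 'I_n -> R) (i j : 'I_n) :
  \prod_l v l ^+ (mpoly.mnm_add (mpoly.mnm1 i) (mpoly.mnm1 j)) l = v i * v j.
Proof. by rewrite -mpoly.mevalX mpoly.mpolyXD mpoly.mevalM !mpoly.mevalXU. Qed.

Lemma continuous_monomial (R : realType) (T : topologicalType) (n : nat)
    (f : 'I_n -> T -> R) (m : 'I_n -> nat) :
  (forall i, continuous (f i)) -> continuous (fun t => \prod_i f i t ^+ m i).
Proof.
move=> cf; elim: (index_enum _) => [|i r ih].
  by under eq_fun do rewrite big_nil; exact: cst_continuous.
under eq_fun do rewrite big_cons; apply: continuous_fun_mul => // t.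
apply: (@continuous_comp _ _ _ (f i) (fun u : R => u ^+ m i)); first exact: cf.
exact: exprn_continuous.
Qed.

Lemma continuous_rV_monomial (R : realType) (n : nat) (m : 'I_n -> nat) :
  continuous (fun v : 'rV[R]_n => \prod_i v ord0 i ^+ m i).
Proof.
apply: (continuous_monomial R ('rV[R]_n) n (fun i v => v ord0 i)) => i.
exact: coord_continuous.
Qed.

Theorem lemma7 (R : realType) (k : nat) (x : 'I_k -> R -> R) (z : R -> R)
    (sigma : probability (borel_rV R (2 * k).+1) R)
    (hk : (0 < k)%N)
    (hsigma : uniform_sphere_measure sigma)
    (hxC1 : forall j, continuously_differentiable (x j))
    (hxper : forall j, periodic (x j) (pi / k.+1%:R))
    (hzC1 : continuously_differentiable z)
    (hzanti : antiperiodic z (pi / k.+1%:R))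
    (hsphere : forall theta, \sum_(j < k) x j theta ^+ 2 + z theta ^+ 2 = 1)
    (hint : forall j,
      \int[lebesgue_measure]_(theta in `[0, 2 * pi])
        ((x j theta ^+ 2 - 2 / (2 * k + 1)%:R) *
         Num.sqrt (\sum_(l < k) (derive1 (x l) theta ^+ 2 +
                                 l.+1%:R ^+ 2 * x l theta ^+ 2)
                   + derive1 z theta ^+ 2)) = 0) :
  spherical_design_curve sigma 2 (twisted_curve x z).
Proof.
split; first exact: twisted_curve_closed.
move=> p hp.
(* The design condition integrates over a half-open interval and the moments over a closed one; the
   endpoint is negligible. *)
have half_open (f : R -> R) : continuous f ->
    \int[lebesgue_measure]_(u in `[0, 2 * pi[)
      (f u * enorm (derive1 (twisted_curve x z) u)) =
    \int[lebesgue_measure]_(u in `[0, 2 * pi]) (f u * speed x z u).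
  move=> cf; under eq_Rintegral do rewrite enorm_derive1 //.
  rewrite Rintegral_itv_bndo_bndc //.
  apply: (@integrableS _ _ _ lebesgue_measure `[0, 2 * pi]) => //.
    by apply: subset_itvl; rewrite bnd_simp.
  apply: continuous_integrable_segment.
  by apply: continuous_fun_mul => //; exact: speed_continuous.
have lenE : curve_length (twisted_curve x z) = len x z.
  rewrite /curve_length /len.
  under eq_Rintegral do rewrite -[enorm _]mul1r.
  rewrite half_open; last exact: cst_continuous.
  by apply: eq_Rintegral => u _; rewrite mul1r.
have l0 : 0 < len x z by exact: len_gt0.
have cc i : continuous (coord x z i) by exact: twisted_coord_continuous.
have ccm (m : mpoly.multinom (2 * k).+1) :
    continuous (fun u => \prod_(i < (2 * k).+1) coord x z i u ^+ m i).
  exact: (continuous_monomial _ _ _ (fun i : 'I_(2 * k).+1 => coord x z i) m).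
(* Both sides are linear in [p], so each is expanded into monomials. *)
transitivity (\sum_(m <- mpoly.msupp p) mpoly.mcoeff m p *
    \int[sigma]_(v in (sphere R (2 * k) : set (borel_rV R (2 * k).+1)))
      \prod_i (v : 'rV[R]_(2 * k).+1) ord0 i ^+ m i).
  have I (m : mpoly.multinom (2 * k).+1) : sigma.-integrable
      (sphere R (2 * k) : set (borel_rV R (2 * k).+1))
      (EFin \o (fun v : 'rV[R]_(2 * k).+1 => \prod_i v ord0 i ^+ m i)).
    apply: (integrable_sphere _ hsigma _ 1).
      exact: continuous_rV_monomial.
    (* Coordinates on the sphere are at most 1 in absolute value, hence so are all monomials. *)
    move=> v Sv; rewrite normr_prod; apply: prodr_ile1 => i _.
    by rewrite normr_ge0 normrX exprn_ile1 // sphere_coord_le1.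
  under eq_Rintegral do rewrite mpoly.mevalE.
  rewrite Rintegral_sum; last 2 first.
  - exact: measurable_sphere.
  - by move=> m; apply: integrable_scale; [exact: measurable_sphere|exact: I].
  apply: eq_bigr => m _; rewrite RintegralZl //.
  exact: measurable_sphere.
transitivity ((curve_length (twisted_curve x z))^-1 *
  \sum_(m <- mpoly.msupp p) mpoly.mcoeff m p *
    \int[lebesgue_measure]_(u in `[0, 2 * pi])
      (\prod_(i < (2 * k).+1) coord x z i u ^+ m i * speed x z u)); last first.
  congr (_ * _).
  transitivity (\int[lebesgue_measure]_(u in `[0, 2 * pi[)
    ((\sum_(m <- mpoly.msupp p) mpoly.mcoeff m p *
      \prod_(i < (2 * k).+1) coord x z i u ^+ m i) *
       enorm (derive1 (twisted_curve x z) u))); last first.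
    apply: eq_Rintegral => u _; rewrite mpoly.mevalE; congr (_ * _).
    apply: eq_bigr => m _; congr (_ * _).
    by apply: eq_bigr => i _; rewrite twisted_curveE.
  rewrite half_open; last first.
    apply: continuous_sum => m.
    by apply: continuous_fun_mul; [exact: cst_continuous|exact: ccm].
  under [RHS]eq_Rintegral => u _.
    rewrite mulr_suml; under eq_bigr do rewrite -mulrA.
    over.
  have I (m : mpoly.multinom (2 * k).+1) :
      lebesgue_measure.-integrable `[0, 2 * pi] (EFin \o (fun u =>
        \prod_(i < (2 * k).+1) coord x z i u ^+ m i * speed x z u)).
    apply: continuous_integrable_segment.
    by apply: continuous_fun_mul => //; exact: speed_continuous.
  rewrite Rintegral_sum //; last by move=> m; apply: integrable_scale.
  by apply: eq_bigr => m _; rewrite RintegralZl.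
rewrite lenE mulr_sumr; apply: eq_big_seq => m mp.
rewrite mulrCA; congr (_ * _).
have : (mpoly.mdeg m < 3)%N.
  by apply: leq_trans hp; exact: mpoly.msize_mdeg_lt.
move=> /mpoly_monomial_le2[->|[i ->]|[i [j ->]]].
- have one (v : 'I_(2 * k).+1 -> R) :
      \prod_i v i ^+ (mpoly.mnm0 : mpoly.multinom _) i = 1.
    by rewrite big1 // => i _; rewrite mpoly.mnm0E expr0.
  under eq_Rintegral do rewrite one.
  under [in RHS]eq_Rintegral do rewrite (one (fun i => coord x z i _)) mul1r.
  (* Both averages of the constant 1 are 1; positivity of the length permits the division. *)
  by rewrite Rintegral_sphere1 // mulVf // gt_eqF.
- under eq_Rintegral do rewrite (prod_mnm1 _ _ (fun i => (_ : 'rV_ _) ord0 i)).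
  under [in RHS]eq_Rintegral do
    rewrite (prod_mnm1 _ _ (fun i => coord x z i _)).
  by rewrite sphere_moment1 // coord_moment1 // mulr0.
- under eq_Rintegral do rewrite (prod_mnm2 _ _ (fun i => (_ : 'rV_ _) ord0 i)).
  under [in RHS]eq_Rintegral do
    rewrite (prod_mnm2 _ _ (fun i => coord x z i _)).
  have [->|ij] := eqVneq i j.
    (* Dividing by the length turns the curve moment into 1/(2k + 1), the second moment on the
       sphere in dimension 2k. *)
    rewrite sphere_moment2 // coord_moment2_eq // mulrA mulVf ?mul1r //.
    by rewrite gt_eqF.
  by rewrite sphere_moment2_neq // coord_moment2_neq // mulr0.
Qed.
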